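(* Let $k$ be a field of characteristic $p>0$, let $k'/k$ be a finite purely inseparable field extension of exponent $e$, and let $G=\mathrm{R}_{k'/k}(\mathrm{GL}_r)$. Then the exponent of $\mathscr R_u(G_{\bar k})$ is at most $s$, where the integer $s$ is chosen so that $p^s\ge r^2(p^e-1)$. In particular, if $p\ge r^2$, then this exponent is at most $e+1$.
   Context: $\mathrm{R}_{k'/k}(\mathrm{GL}_r)$ is the Weil restriction: the $k$-group with $A$-points $\mathrm{GL}_r(k'\otimes_k A)$ for $k$-algebras $A$. $\mathscr R_u(G_{\bar k})$ denotes the unipotent radical of $G_{\bar k}$, where $\bar k$ is an algebraic closure of $k$. The exponent of a unipotent group $U$ in characteristic $p$ is the minimal integer $s$ such that the $p^s$-power map on $U$ factors through the trivial group. The exponent of a finite purely inseparable extension $k'/k$ is the minimal $e$ such that $x^{p^e}\in k$ for all $x\in k'$.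
   Formalization: The single case r = 1, p = 2, e = 1, s = 0 is excluded from the first claim, since there p^s = r^2(p^e-1) = 1 but the unipotent radical is nontrivial (e.g. G_a for k' = k(√t)), of exponent at least 1; s is taken to be a nonnegative integer. *)

(* Defs.v *)
From HB Require Import structures.
From mathcomp Require Import all_boot all_order all_algebra all_field.

Set Implicit Arguments.
Unset Strict Implicit.
Unset Printing Implicit Defensive.

Import GRing.Theory.
Local Open Scope ring_scope.

Definition is_minimal (P : nat -> Prop) (n : nat) : Prop :=
  P n /\ forall m, P m -> (n <= m)%N.

(* The k-algebra structure of a commutative ring A is given by its structure
   morphism phi, so that restricting scalars is composing morphisms.
   [tensor k' phi] is k' (x)_k A: the row vector x stands for
   \sum_i b_i (x) x_i, where b is the basis [vbasis {:k'}] of k' over k.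
   The universal property is [tensor_lift] together with [tensor_lift_uniq]. *)
Definition tensor (k : fieldType) (k' : fieldExtType k) (A : comNzRingType)
  (phi : {rmorphism k -> A}) : Type := 'rV[A]_(\dim {:k'}).

HB.instance Definition _ (k : fieldType) (k' : fieldExtType k)
  (A : comNzRingType) (phi : {rmorphism k -> A}) :=
  GRing.Lmodule.copy (tensor k' phi) 'rV[A]_(\dim {:k'}).

Section TensorRing.
Variables (k : fieldType) (k' : fieldExtType k) (A : comNzRingType).
Variable phi : {rmorphism k -> A}.

Local Notation T := (tensor k' phi).
Local Notation n := (\dim {:k'}).
Local Notation b := (vbasis {:k'}).

(* z (x) 1 *)
Definition tens_l (z : k') : T := \row_i phi (coord b i z).

Definition tens_mul (x y : T) : T :=
  \sum_(i < n) \sum_(j < n) (x 0 i * y 0 j) *: tens_l (b`_i * b`_j).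

Lemma tens_l_semilinear (a : k) (z w : k') :
  tens_l (a *: z + w) = phi a *: tens_l z + tens_l w.
Proof.
by apply/rowP => i; rewrite !mxE linearP rmorphD rmorphM.
Qed.

Lemma tens_lD z w : tens_l (z + w) = tens_l z + tens_l w.
Proof. by rewrite -[z in LHS]scale1r tens_l_semilinear rmorph1 scale1r. Qed.

Lemma tens_l0 : tens_l 0 = 0.
Proof. by apply/rowP => i; rewrite !mxE linear0 rmorph0. Qed.

Lemma tens_lZ a z : tens_l (a *: z) = phi a *: tens_l z.
Proof. by rewrite -[a *: z]addr0 tens_l_semilinear tens_l0 addr0. Qed.

Lemma tens_l_sum (I : finType) (F : I -> k') :
  tens_l (\sum_i F i) = \sum_i tens_l (F i).
Proof. by apply: (big_morph tens_l tens_lD tens_l0). Qed.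

Lemma tens_l_basis (i : 'I_n) : tens_l b`_i = delta_mx 0 i.
Proof.
apply/rowP => j; rewrite !mxE eqxx /= coord_free.
  by rewrite rmorph_nat eq_sym.
exact: basis_free (vbasisP fullv).
Qed.

Lemma tens_expand (x : T) : x = \sum_(i < n) x 0 i *: tens_l b`_i.
Proof.
rewrite [LHS]row_sum_delta; apply: eq_bigr => i _.
by rewrite tens_l_basis.
Qed.

Lemma tens_mulDl : left_distributive tens_mul +%R.
Proof.
move=> x y z; rewrite /tens_mul -big_split; apply: eq_bigr => i _ /=.
rewrite -big_split; apply: eq_bigr => j _ /=.
by rewrite mxE mulrDl scalerDl.
Qed.

Lemma tens_mulC : commutative tens_mul.
Proof.
move=> x y; rewrite /tens_mul exchange_big /=; apply: eq_bigr => i _.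
by apply: eq_bigr => j _; rewrite mulrC [b`_j * _]mulrC.
Qed.

Lemma tens_mulZl (a : A) x y : tens_mul (a *: x) y = a *: tens_mul x y.
Proof.
rewrite /tens_mul scaler_sumr; apply: eq_bigr => i _.
rewrite scaler_sumr; apply: eq_bigr => j _.
by rewrite mxE scalerA mulrA.
Qed.

Lemma tens_mulDr : right_distributive tens_mul +%R.
Proof. by move=> x y z; rewrite !(tens_mulC x) tens_mulDl. Qed.

Lemma tens_mulZr (a : A) x y : tens_mul x (a *: y) = a *: tens_mul x y.
Proof. by rewrite !(tens_mulC x) tens_mulZl. Qed.

Lemma tens_mul0l y : tens_mul 0 y = 0.
Proof. by rewrite -[0 in LHS](scale0r (0 : T)) tens_mulZl scale0r. Qed.

Lemma tens_mul_suml (I : finType) (F : I -> T) y :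
  tens_mul (\sum_i F i) y = \sum_i tens_mul (F i) y.
Proof.
exact: (big_morph (tens_mul^~ y) (fun u v => tens_mulDl u v y) (tens_mul0l y)).
Qed.

Lemma tens_mul_sumr (I : finType) (F : I -> T) x :
  tens_mul x (\sum_i F i) = \sum_i tens_mul x (F i).
Proof. by rewrite tens_mulC tens_mul_suml; apply: eq_bigr => i _; exact: tens_mulC. Qed.

Lemma tens_mul_basis (i j : 'I_n) :
  tens_mul (tens_l b`_i) (tens_l b`_j) = tens_l (b`_i * b`_j).
Proof.
rewrite /tens_mul (bigD1 i) //= [X in _ + X]big1 => [|i' ne].
  rewrite addr0 (bigD1 j) //= [X in _ + X]big1 => [|j' ne].
    by rewrite addr0 !tens_l_basis !mxE !eqxx mulr1 scale1r.
  by rewrite !tens_l_basis !mxE (negPf ne) andbF mulr0 scale0r.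
rewrite big1 // => j' _.
by rewrite !tens_l_basis !mxE (negPf ne) andbF mul0r scale0r.
Qed.

Lemma tens_mul_l z w : tens_mul (tens_l z) (tens_l w) = tens_l (z * w).
Proof.
rewrite (coord_vbasis (memvf z)) (coord_vbasis (memvf w)).
rewrite mulr_suml !tens_l_sum tens_mul_suml; apply: eq_bigr => i _.
rewrite mulr_sumr tens_l_sum tens_mul_sumr; apply: eq_bigr => j _.
rewrite !tens_lZ tens_mulZl tens_mulZr tens_mul_basis.
by rewrite -scalerAl -scalerAr !tens_lZ.
Qed.

Lemma tens_ind (P : T -> Prop) :
  (forall z, P (tens_l z)) -> (forall (a : A) x, P x -> P (a *: x)) ->
  (forall x y, P x -> P y -> P (x + y)) -> forall x, P x.
Proof.
move=> Pl PZ PD x; rewrite (tens_expand x).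
elim/big_ind: _ => //; first by rewrite -tens_l0.
by move=> i _; apply: PZ.
Qed.

Lemma tens_mulA : associative tens_mul.
Proof.
move=> x y z; elim/tens_ind: x => [x|a x IHx|x x' IHx IHx'].
- elim/tens_ind: y => [y|a y IHy|y y' IHy IHy'].
  + elim/tens_ind: z => [z|a z IHz|z z' IHz IHz'].
    * by rewrite !tens_mul_l mulrA.
    * by rewrite !tens_mulZr IHz.
    * by rewrite !tens_mulDr IHz IHz'.
  + by rewrite tens_mulZl !tens_mulZr tens_mulZl IHy.
  + by rewrite tens_mulDl !tens_mulDr tens_mulDl IHy IHy'.
- by rewrite !tens_mulZl IHx.
- by rewrite !tens_mulDl IHx IHx'.
Qed.

Lemma tens_mul1l : left_id (tens_l 1) tens_mul.
Proof.
elim/tens_ind => [x|a x IHx|x x' IHx IHx'].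
- by rewrite tens_mul_l mul1r.
- by rewrite tens_mulZr IHx.
- by rewrite tens_mulDr IHx IHx'.
Qed.

Lemma tens_1_neq0 : tens_l 1 != 0.
Proof.
apply/eqP => /rowP e0; have /eqP[] := oner_neq0 k'.
rewrite (coord_vbasis (memvf 1)) big1 // => i _.
have := e0 i; rewrite !mxE => /eqP; rewrite fmorph_eq0 => /eqP ->.
by rewrite scale0r.
Qed.

HB.instance Definition _ := GRing.Zmodule_isComNzRing.Build T
  tens_mulA tens_mulC tens_mul1l tens_mulDl tens_1_neq0.

(* 1 (x) a *)
Definition tens_r (a : A) : T := a *: (1 : T).

Lemma tens_l_is_zmod : zmod_morphism tens_l.
Proof. by move=> x y; rewrite tens_lD -scaleN1r tens_lZ rmorphN1 scaleN1r. Qed.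
Lemma tens_l_is_monoid : monoid_morphism tens_l.
Proof. by split=> // x y; rewrite -tens_mul_l. Qed.
HB.instance Definition _ := GRing.isZmodMorphism.Build k' T tens_l tens_l_is_zmod.
HB.instance Definition _ := GRing.isMonoidMorphism.Build k' T tens_l tens_l_is_monoid.

Lemma tens_scaleE (a : A) (x : T) : a *: x = tens_r a * x.
Proof. by rewrite /tens_r [RHS]tens_mulZl tens_mul1l. Qed.

Lemma tens_r_is_zmod : zmod_morphism tens_r.
Proof. by move=> x y; rewrite /tens_r scalerBl. Qed.
Lemma tens_r_is_monoid : monoid_morphism tens_r.
Proof.
split=> [|x y]; first exact: scale1r.
by rewrite -tens_scaleE /tens_r scalerA.
Qed.
HB.instance Definition _ := GRing.isZmodMorphism.Build A T tens_r tens_r_is_zmod.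
HB.instance Definition _ := GRing.isMonoidMorphism.Build A T tens_r tens_r_is_monoid.

Lemma tens_lr (a : k) : tens_l a%:A = tens_r (phi a).
Proof. exact: tens_lZ. Qed.

Lemma tens_expandE (x : T) : x = \sum_(i < n) tens_r (x 0 i) * tens_l b`_i.
Proof. by rewrite {1}(tens_expand x); apply: eq_bigr => i _; rewrite tens_scaleE. Qed.

Lemma tensor_lift_uniq (B : comNzRingType) (F G : {rmorphism T -> B}) :
  (forall z, F (tens_l z) = G (tens_l z)) ->
  (forall a, F (tens_r a) = G (tens_r a)) -> F =1 G.
Proof.
move=> Hl Hr x; rewrite (tens_expandE x) !rmorph_sum.
by apply: eq_bigr => i _; rewrite !rmorphM Hl Hr.
Qed.

Lemma tensor_lift (B : comNzRingType) (f : {rmorphism k' -> B})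
    (g : {rmorphism A -> B}) :
  (forall a : k, f a%:A = g (phi a)) ->
  exists F : {rmorphism T -> B},
    (forall z, F (tens_l z) = f z) /\ (forall a, F (tens_r a) = g a).
Proof.
move=> fg; pose h (x : T) := \sum_(i < n) g (x 0 i) * f b`_i.
have hl z : h (tens_l z) = f z.
  rewrite [in RHS](coord_vbasis (memvf z)) rmorph_sum; apply: eq_bigr => i _.
  by rewrite mxE -mulr_algl rmorphM fg.
have hD : zmod_morphism h.
  move=> x y; rewrite /h -sumrB; apply: eq_bigr => i _.
  by rewrite !mxE rmorphB mulrBl.
have hZ a x : h (a *: x) = g a * h x.
  by rewrite /h mulr_sumr; apply: eq_bigr => i _; rewrite mxE rmorphM mulrA.
pose hA := GRing.isZmodMorphism.Build T B h hD.
pose H : {additive T -> B} := HB.pack h hA.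
have hM : monoid_morphism h.
  split=> [|x y]; first by rewrite [h 1]hl rmorph1.
  rewrite -[h (x * y)]/(H (tens_mul x y)) /tens_mul raddf_sum /h mulr_suml.
  apply: eq_bigr => i _; rewrite raddf_sum mulr_sumr; apply: eq_bigr => j _.
  by rewrite [LHS]hZ hl !rmorphM mulrACA.
pose hMM := GRing.isMonoidMorphism.Build T B h hM.
pose HR : {rmorphism T -> B} := HB.pack h hA hMM.
exists HR; split=> [z|a]; first exact: hl.
by rewrite [LHS]hZ [h 1]hl rmorph1 mulr1.
Qed.

End TensorRing.

(* k' (x) A -> k' (x) A' induced by f : A -> A', applied entrywise. *)
Definition tensor_mx (k : fieldType) (k' : fieldExtType k)
    (A A' : comNzRingType) (phi : {rmorphism k -> A}) (phi' : {rmorphism k -> A'})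
    (r : nat) (f : A -> A') (g : 'M[tensor k' phi]_r) : 'M[tensor k' phi']_r :=
  map_mx (fun x : tensor k' phi => map_mx f x : tensor k' phi') g.

(* A-points of R_{k'/k}(GL_r): the invertible matrices over k' (x)_k A. *)
Definition weil_GL (k : fieldType) (k' : fieldExtType k) (r : nat)
    (A : comNzRingType) (phi : {rmorphism k -> A})
    (g : 'M[tensor k' phi]_r) : Prop :=
  exists h : 'M[tensor k' phi]_r, g *m h = 1%:M /\ h *m g = 1%:M.

Inductive subalg_gen (K : fieldType) (R : comAlgType K) (X : R -> Prop) :
    R -> Prop :=
  | subalg_gen_base x : X x -> subalg_gen X x
  | subalg_gen_scalar a : subalg_gen X a%:A
  | subalg_gen_add x y : subalg_gen X x -> subalg_gen X y -> subalg_gen X (x + y)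
  | subalg_gen_mul x y : subalg_gen X x -> subalg_gen X y -> subalg_gen X (x * y).

Section GroupsOverK.
Variables (k : fieldType) (k' : fieldExtType k) (r : nat).
Variables (K : fieldType) (iota : {rmorphism k -> K}).

Definition restr (A : comAlgType K) : {rmorphism k -> A} := GRing.in_alg A \o iota.

(* Group schemes over K are given by their functors of points; those below are
   subfunctors of A |-> M_r(k' (x)_k A), where A is a K-algebra. *)
Definition subfunctor : Type :=
  forall A : comAlgType K, 'M[tensor k' (restr A)]_r -> Prop.

(* The base change of R_{k'/k}(GL_r) along iota. *)
Definition weil_GL_K : subfunctor := fun A => @weil_GL k k' r A (restr A).

Definition sub_functor (U V : subfunctor) : Prop := forall A g, U A g -> V A g.

Definition push (A B : comAlgType K) (f : {lrmorphism A -> B})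
    (g : 'M[tensor k' (restr A)]_r) : 'M[tensor k' (restr B)]_r :=
  tensor_mx (restr B) f g.

Definition subgroup_functor (U : subfunctor) : Prop :=
  [/\ sub_functor U weil_GL_K,
      forall (A B : comAlgType K) (f : {lrmorphism A -> B}) g,
        U A g -> U B (push f g),
      forall A, U A 1%:M,
      forall A g h, U A g -> U A h -> U A (g *m h)
    & forall A g h, U A g -> g *m h = 1%:M -> h *m g = 1%:M -> U A h].

(* R is the coordinate ring of a closed subscheme U of weil_GL_K, u being the
   universal point: every point of U is a specialization of u, and the
   coordinates of u and of its inverse generate R, i.e. K[weil_GL_K] -> R is
   surjective (so that the specialization is unique). *)
Definition coordinate_ring (U : subfunctor) (R : comAlgType K)
    (u : 'M[tensor k' (restr R)]_r) : Prop :=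
  [/\ U R u,
      forall A g, U A g -> exists f : {lrmorphism R -> A}, push f u = g
    & forall v : 'M[tensor k' (restr R)]_r, u *m v = 1%:M -> v *m u = 1%:M ->
        forall x : R, subalg_gen
          (fun y => exists i j l, y = u i j 0 l \/ y = v i j 0 l) x].

Definition closed_subgroup (U : subfunctor) : Prop :=
  subgroup_functor U /\ exists R u, @coordinate_ring U R u.

(* Spec R is connected: R (nonzero, as any algebra here) has no idempotent
   besides 0 and 1. *)
Definition connected (U : subfunctor) : Prop :=
  forall R u, @coordinate_ring U R u -> forall x : R, x * x = x -> x = 0 \/ x = 1.

(* Infinitesimal lifting criterion; closed subgroups are of finite type. *)
Definition smooth (U : subfunctor) : Prop :=
  forall (A B : comAlgType K) (f : {lrmorphism A -> B}),
    (forall y, exists x, f x = y) ->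
    (forall x y, f x = 0 -> f y = 0 -> x * y = 0) ->
    forall g, U B g -> exists2 h, U A h & push f h = g.

Definition normal_in (G U : subfunctor) : Prop :=
  forall A g h u, G A g -> g *m h = 1%:M -> h *m g = 1%:M ->
    U A u -> U A (g *m u *m h).

(* A homomorphism of group functors U -> GL_m; only the values of rho on U
   matter. *)
Definition representation (U : subfunctor) (m : nat)
    (rho : forall A : comAlgType K, 'M[tensor k' (restr A)]_r -> 'M[A]_m) : Prop :=
  [/\ forall A, rho A 1%:M = 1%:M,
      forall A g h, U A g -> U A h -> rho A (g *m h) = rho A g *m rho A h
    & forall (A B : comAlgType K) (f : {lrmorphism A -> B}) g,
        U A g -> rho B (push f g) = map_mx f (rho A g)].

(* Every nonzero finite-dimensional representation has a nonzero fixed vector. *)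
Definition unipotent (U : subfunctor) : Prop :=
  forall m rho, (0 < m)%N -> @representation U m rho ->
    exists2 v : 'cV[K]_m, v != 0 &
      forall A g, U A g ->
        rho A g *m map_mx (GRing.in_alg A) v = map_mx (GRing.in_alg A) v.

Definition smooth_connected_normal_unipotent (G U : subfunctor) : Prop :=
  [/\ closed_subgroup U, smooth U, connected U, normal_in G U & unipotent U].

(* The largest smooth connected normal unipotent subgroup; this is the
   unipotent radical when K is algebraically closed. *)
Definition is_unipotent_radical (G U : subfunctor) : Prop :=
  smooth_connected_normal_unipotent G U /\
  forall V, smooth_connected_normal_unipotent G V -> sub_functor V U.

Definition power_trivial (U : subfunctor) (n : nat) : Prop :=
  forall A g, U A g -> g ^+ n = 1%:M.

Definition is_group_exponent (p : nat) (U : subfunctor) : nat -> Prop :=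
  is_minimal (fun s => power_trivial U (p ^ s)).

Definition group_exponent_at_most (p : nat) (U : subfunctor) (s : nat) : Prop :=
  exists2 n, is_group_exponent p U n & (n <= s)%N.

End GroupsOverK.

Arguments weil_GL_K {k} k' r {K} iota A g.

Definition is_field_exponent (p : nat) (k : fieldType) (k' : fieldExtType k) :
    nat -> Prop :=
  is_minimal (fun e => forall x : k', x ^+ (p ^ e) \in 1%VS).

Definition is_algebraic_closure (k : fieldType) (K : closedFieldType)
    (iota : {rmorphism k -> K}) : Prop :=
  forall x : K, algebraicOver iota x.

(* Main.v *)
Require Import Defs.
From HB Require Import structures.
From mathcomp Require Import all_boot all_order all_algebra all_field.
From mathcomp Require Import zify.
From Stdlib Require Import Classical.

Set Implicit Arguments.
Unset Strict Implicit.
Unset Printing Implicit Defensive.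

Import GRing.Theory.
Local Open Scope ring_scope.

(** Let q = p^e. As K is algebraically closed, k' embeds in K over k, whence
    retractions pi_A : k' (x)_k A -> A with x^q = 1 (x) pi_A(x)^q. Entrywise
    application of pi is a representation of U on K^r; its fixed vectors form
    a nonzero subspace which, by normality, is stable under GL_r(K), hence is
    everything. So each g in U(A) is 1 + N with pi(N) = 0. The non-leading
    coefficients of the characteristic polynomial chi of N then have zero q-th
    power, so chi^q = X^(rq) and Cayley-Hamilton gives N^(rq) = 0. This
    suffices because rq <= r^2 (q - 1) as soon as r, q >= 2. *)

(** * Frobenius powers and the embedding of k' into K *)

Lemma pchar_nat_expn (L : nzRingType) (p e : nat) :
  p \in [pchar L] -> [pchar L].-nat (p ^ e)%N.
Proof. by move=> hp; rewrite pnatX pnatE ?hp ?(pcharf_prime hp). Qed.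

Lemma pchar_expr_inj (F : fieldType) (p e : nat) :
  p \in [pchar F] -> injective (fun x : F => x ^+ (p ^ e)).
Proof.
move=> hp x y /= /eqP; rewrite -subr_eq0.
have hq := pchar_nat_expn e hp.
rewrite -exprNn_pchar // -exprDn_pchar // expf_eq0 subr_eq0.
by case/andP => _ /eqP.
Qed.

Lemma closed_expr_root (K : closedFieldType) (n : nat) (a : K) :
  (0 < n)%N -> exists y : K, y ^+ n == a.
Proof.
move=> n0; have [y hy] := @solve_monicpoly K n (fun i => if i == 0%N then a else 0) n0.
exists y; rewrite hy; case: n n0 {hy} => // n _.
by rewrite big_ord_recl /= mulr1 big1 ?addr0 // => i _; rewrite mul0r.
Qed.

(** Let [c x] be x^q read in k, and [j x] a q-th root of its image in K. Since q-th roots in K are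
    unique, each identity for [j] may be checked after raising to the power q, where it becomes an
    identity for [c]. *)
Lemma purely_insep_embedding (k : fieldType) (k' : fieldExtType k)
    (K : closedFieldType) (iota : {rmorphism k -> K}) (p e : nat) :
  p \in [pchar k] -> (forall x : k', x ^+ (p ^ e) \in 1%VS) ->
  exists j : {rmorphism k' -> K}, forall a : k, j a%:A = iota a.
Proof.
move=> hp he; have hpK := rmorph_pchar iota hp.
have pr_p := pcharf_prime hp.
have q0 : (0 < p ^ e)%N by rewrite expn_gt0 prime_gt0.
have hpk' : p \in [pchar k'] by rewrite (rmorph_pchar (GRing.in_alg k')).
have qinj := @pchar_expr_inj K p e hpK.
have exc (x : k') : exists a : k, x ^+ (p ^ e) == a%:A.
  by have /vlineP[a ->] := he x; exists a.
pose c x := xchoose (exc x).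
have cE x : x ^+ (p ^ e) = (c x)%:A by apply/eqP; exact: (xchooseP (exc x)).
pose j x := xchoose (closed_expr_root (iota (c x)) q0).
have jE x : j x ^+ (p ^ e) = iota (c x).
  by apply/eqP; exact: (xchooseP (closed_expr_root (iota (c x)) q0)).
have alg_inj : injective (GRing.in_alg k') by exact: fmorph_inj.
have cB x y : c (x - y) = c x - c y.
  apply: alg_inj; rewrite rmorphB /= -!cE.
  by rewrite exprDn_pchar ?exprNn_pchar ?pchar_nat_expn.
have cM x y : c (x * y) = c x * c y.
  by apply: alg_inj; rewrite rmorphM /= -!cE exprMn.
have cA a : c a%:A = a ^+ (p ^ e).
  by apply: alg_inj; rewrite /= -cE exprZn expr1n.
have jA a : j a%:A = iota a by apply: qinj; rewrite /= jE cA rmorphXn.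
have jB : zmod_morphism j.
  move=> x y; apply: qinj; rewrite /= jE cB rmorphB -!jE.
  by rewrite exprDn_pchar ?exprNn_pchar ?pchar_nat_expn.
have jM : monoid_morphism j.
  split=> [|x y]; first by rewrite -(scale1r 1) jA rmorph1.
  by apply: qinj; rewrite /= jE cM rmorphM -!jE exprMn.
pose jBm := GRing.isZmodMorphism.Build k' K j jB.
pose jMm := GRing.isMonoidMorphism.Build k' K j jM.
by exists (HB.pack j jBm jMm : {rmorphism k' -> K}).
Qed.

(** * The retractions pi_A and their action on U *)

Section Retraction.
Variables (k : fieldType) (k' : fieldExtType k).
Variables (K : fieldType) (iota : {rmorphism k -> K}).
Variables (j : {rmorphism k' -> K}) (jA : forall a : k, j a%:A = iota a).

(** This is pi_A, sending z (x) a to j(z) a, written in coordinates so that one formula serves every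
    A. *)
Definition retr (A : comAlgType K) (x : tensor k' (restr iota A)) : A :=
  \sum_i x 0 i * (j (vbasis {:k'})`_i)%:A.

Arguments retr : clear implicits.

Lemma retr_rmorphism (A : comAlgType K) :
  exists F : {rmorphism tensor k' (restr iota A) -> A},
    @retr A =1 F /\ forall a, F (tens_r k' (restr iota A) a) = a.
Proof.
have [F [Fl Fr]] := @tensor_lift k k' A (restr iota A) A
  (GRing.in_alg A \o j) idfun (fun a => congr1 (GRing.in_alg A) (jA a)).
exists F; split=> // x; rewrite {2}(tens_expandE x) rmorph_sum /retr.
by apply: eq_bigr => i _; rewrite rmorphM Fl Fr.
Qed.

Lemma retr_natural (A B : comAlgType K) (f : {lrmorphism A -> B})
    (x : tensor k' (restr iota A)) :
  retr B (map_mx f x : tensor k' (restr iota B)) = f (retr A x).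
Proof.
rewrite /retr rmorph_sum; apply: eq_bigr => i _.
by rewrite rmorphM mxE /= linearZ_LR rmorph1.
Qed.

(** By additivity of Frobenius only the basis vectors b_i matter: b_i^q is a scalar from k, so it
    crosses the tensor sign, and its image in K is j(b_i)^q. *)
Lemma retr_expr (A : comAlgType K) (p e : nat) (x : tensor k' (restr iota A)) :
  p \in [pchar k] -> (forall z : k', z ^+ (p ^ e) \in 1%VS) ->
  x ^+ (p ^ e) = tens_r k' (restr iota A) (retr A x ^+ (p ^ e)).
Proof.
move=> hp he; have pr_p := pcharf_prime hp.
have sumX (L : comNzRingType) (I : finType) (f : I -> L) : p \in [pchar L] ->
    (\sum_i f i) ^+ (p ^ e) = \sum_i f i ^+ (p ^ e).
  move=> h; apply: (big_morph (fun y : L => y ^+ (p ^ e))) => [y z|].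
    by rewrite exprDn_pchar ?pchar_nat_expn.
  by rewrite expr0n expn_eq0 (gtn_eqF (prime_gt0 pr_p)).
have hpA := rmorph_pchar (restr iota A) hp.
rewrite {1}(tens_expandE x) /retr !sumX //; last first.
  exact: (rmorph_pchar (tens_r k' (restr iota A)) hpA).
rewrite rmorph_sum; apply: eq_bigr => i _; rewrite !exprMn rmorphM.
rewrite -!rmorphXn; congr (_ * _).
have /vlineP[a ha] := he (vbasis {:k'})`_i.
by rewrite ha [LHS]tens_lr exprZn expr1n -rmorphXn ha jA.
Qed.

Lemma retr_representation (r : nat) (U : subfunctor k' r iota) :
  representation U (fun A => map_mx (retr A)).
Proof.
have E (A : comAlgType K) : exists F : {rmorphism tensor k' (restr iota A) -> A},
    forall g : 'M_r, map_mx (retr A) g = map_mx F g.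
  have [F [FE _]] := retr_rmorphism A; exists F => g.
  by apply/matrixP => i l; rewrite !mxE FE.
split=> [A|A g h _ _|A B f g _].
- by have [F FE] := E A; rewrite FE map_mx1.
- by have [F FE] := E A; rewrite !FE map_mxM.
- by apply/matrixP => i l; rewrite !mxE retr_natural.
Qed.

Lemma unipotent_normal_retr1 (r : nat) (U : subfunctor k' r iota) :
  normal_in (weil_GL_K k' r iota) U -> unipotent U ->
  forall A g, U A g -> map_mx (retr A) g = 1%:M.
Proof.
case: r U => [|r'] U nU uU A g Ug; first by rewrite [LHS]flatmx0 [RHS]flatmx0.
have [v v0 fixv] := uU _ _ (ltn0Sn r') (retr_representation U).
have [F [FE Fr]] := retr_rmorphism A.
have mapE (h : 'M_r'.+1) : map_mx (retr A) h = map_mx F h.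
  by apply/matrixP => s l; rewrite !mxE FE.
(* The transvections 1 + E_(l i) move v by v_i e_l, so each e_l, l != i, is
   fixed; then so is v_i e_i. *)
rewrite mapE; set P := map_mx F g.
pose c (w : 'cV[K]_r'.+1) := map_mx (GRing.in_alg A) w.
(* [L] embeds GL_r(K) through the right tensor factor. By normality the conjugate of g by [L M] lies
   in U, and its retraction M P N fixes v; multiplying by N shows that P fixes N v. *)
have fixh (M N : 'M[K]_r'.+1) : M *m N = 1%:M -> N *m M = 1%:M ->
    P *m c (N *m v) = c (N *m v).
  move=> MN NM; pose L (X : 'M[K]_r'.+1) : 'M[tensor k' (restr iota A)]_r'.+1 :=
    map_mx (tens_r k' (restr iota A) \o GRing.in_alg A) X.
  have LM (X Y : 'M[K]_r'.+1) : X *m Y = 1%:M -> L X *m L Y = 1%:M.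
    by move=> XY; rewrite -map_mxM XY map_mx1.
  have FL X : map_mx F (L X) = map_mx (GRing.in_alg A) X.
    by apply/matrixP => s l; rewrite !mxE Fr.
  have UA : U A (L M *m g *m L N).
    by apply: nU => //; [exists (L N); split; exact: LM | exact: LM | exact: LM].
  have := fixv A _ UA; rewrite mapE !map_mxM !FL => fv.
  have := congr1 (mulmx (map_mx (GRing.in_alg A) N)) fv.
  by rewrite !mulmxA -map_mxM NM map_mx1 mul1mx -mulmxA -!map_mxM.
have /existsP[i vi0] : [exists i, v i 0 != 0].
  apply: contraR v0 => /existsPn h; apply/eqP/matrixP => s l.
  by rewrite ord1 mxE; apply/eqP; have := h s; rewrite negbK.
have fixv1 : P *m c v = c v.
  by have := fixh 1%:M 1%:M; rewrite !mul1mx; apply.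
have scal (a : K) (w : 'cV[K]_r'.+1) : a != 0 ->
    P *m c (a *: w) = c (a *: w) -> P *m c w = c w.
  move=> a0; rewrite /c map_mxZ -scalemxAr => /(congr1 ( *:%R a^-1%:A)).
  by rewrite !scalerA -in_algE -rmorphM mulVf // rmorph1 !scale1r.
pose e l : 'cV[K]_r'.+1 := delta_mx l 0.
have fixne l : l != i -> P *m c (e l) = c (e l).
  move=> li; apply: (scal (v i 0)) => //.
  pose E : 'M[K]_r'.+1 := delta_mx l i.
  have EE : E *m E = 0 by rewrite mul_delta_mx_0 // eq_sym.
  have Ev : E *m v = v i 0 *: e l.
    apply/matrixP => s t; rewrite ord1 !mxE (bigD1 i) //= big1 => [|u ui].
      by rewrite !mxE !eqxx !andbT addr0 mulrC.
    by rewrite !mxE (negPf ui) andbF mul0r.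
  (* As E^2 = 0, these two matrices are mutually inverse. *)
  have := fixh (1%:M - E) (1%:M + E).
  rewrite !mulmxDl !mulmxDr !mulmxN !mulNmx !mul1mx !mulmx1 EE Ev oppr0 !addr0.
  rewrite addrNK addrK => /(_ erefl erefl).
  by rewrite /c !map_mxD mulmxDr fixv1 => /addrI.
have fixe l : P *m c (e l) = c (e l).
  case: (eqVneq l i) => [->|/fixne //]; apply: (scal (v i 0)) => //.
  have vE : v = v i 0 *: e i + \sum_(l | l != i) v l 0 *: e l.
    rewrite -(bigD1 i (P := xpredT) (F := fun l => v l 0 *: e l)) //=.
    by rewrite {1}[v]matrix_sum_delta; apply: eq_bigr => s _; rewrite big_ord1.
  have : P *m c (v i 0 *: e i + \sum_(l | l != i) v l 0 *: e l)
       = c (v i 0 *: e i + \sum_(l | l != i) v l 0 *: e l) by rewrite -vE.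
  rewrite /c !map_mxD mulmxDr; set S := map_mx _ (\sum_(_ | _) _).
  have -> : P *m S = S.
    rewrite /S raddf_sum mulmx_sumr; apply: eq_bigr => s si /=.
    by rewrite map_mxZ -scalemxAr fixne.
  by move/addIr.
apply/matrixP => s l; have /matrixP/(_ s 0) := fixe l.
by rewrite /c map_delta_mx -colE !mxE => ->; rewrite andbT.
Qed.

End Retraction.

(** * Powers of 1 + N for N in the kernel of a ring morphism *)

Lemma expmx_eq0_of_ker (T A : comNzRingType) (F : {rmorphism T -> A})
    (p e r : nat) (N : 'M[T]_r.+1) :
  p \in [pchar T] -> (forall x, F x = 0 -> x ^+ (p ^ e) = 0) ->
  map_mx F N = 0 -> N ^+ (r.+1 * p ^ e) = 0.
Proof.
move=> hp Fq FN; set q := (p ^ e)%N.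
have hpP : p \in [pchar {poly T}] by rewrite (rmorph_pchar (polyC (R := T))).
have hq : [pchar {poly T}].-nat q := pchar_nat_expn e hpP.
have q0 : (0 < q)%N by rewrite expn_gt0 prime_gt0 // (pcharf_prime hp).
pose X := char_poly N; pose Q := X - 'X^(r.+1).
(* The zero matrix has characteristic polynomial X^(r+1), so every coefficient of [Q] lies in the
   kernel of F. *)
have FQ : map_poly F Q = 0.
  rewrite rmorphB /= map_polyXn map_char_poly FN /char_poly /char_poly_mx.
  by rewrite map_mx0 subr0 det_scalar subrr.
have Qq : Q ^+ q = 0.
  rewrite -[Q]coefK poly_def.
  rewrite (big_morph (fun y : {poly T} => y ^+ q) (id1 := 0) (op1 := +%R)).
  - apply: big1 => i _; rewrite exprZn Fq ?scale0r //.
    by rewrite -coef_map FQ coef0.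
  - by move=> y z; rewrite exprDn_pchar.
  - by rewrite expr0n (gtn_eqF q0).
have XE : 'X^(r.+1) ^+ q = X ^+ q.
  by rewrite -[X](subrK 'X^(r.+1)) exprDn_pchar // Qq add0r.
have := congr1 (horner_mx N) XE.
rewrite !rmorphXn /= horner_mx_X Cayley_Hamilton -exprM => ->.
by rewrite expr0n (gtn_eqF q0).
Qed.

(** The matrix ring is not commutative, so Frobenius is applied to 1 + X in T[X] and then evaluated
    at N. *)
Lemma expmx_pchar_1D (T : comNzRingType) (p s r : nat) (N : 'M[T]_r.+1) :
  p \in [pchar T] -> (1 + N) ^+ (p ^ s) = 1 + N ^+ (p ^ s).
Proof.
move=> hp; have hpP : p \in [pchar {poly T}].
  by rewrite (rmorph_pchar (polyC (R := T))).
have hq := pchar_nat_expn s hpP.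
have := congr1 (horner_mx N) (exprDn_pchar 1 'X hq).
by rewrite expr1n !(rmorphD, rmorphXn, rmorph1) /= horner_mx_X.
Qed.

(** Turns the vanishing of a power into a bound on the exponent; [P] need not be decidable, hence
    the excluded middle. *)
Lemma is_minimal_exists (P : nat -> Prop) (s : nat) :
  P s -> exists2 n, is_minimal P n & (n <= s)%N.
Proof.
elim/ltn_ind: s => s IH Ps.
have [[m ms Pm]|no] := classic (exists2 m, (m < s)%N & P m).
  by have [n nmin nm] := IH m ms Pm; exists n => //; apply: leq_trans nm (ltnW ms).
exists s => //; split=> // m Pm; rewrite leqNgt; apply/negP => ms.
by apply: no; exists m.
Qed.

Theorem lemma4p4 (k : fieldType) (p : nat) (k' : fieldExtType k) (e r : nat)
    (K : closedFieldType) (iota : {rmorphism k -> K})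
    (U : subfunctor k' r iota)
    (hp : p \in [pchar k])
    (hinsep : purely_inseparable 1%VS {:k'}%VS)
    (he : is_field_exponent p k' e)
    (hK : is_algebraic_closure iota)
    (hU : is_unipotent_radical (weil_GL_K k' r iota) U) :
  (forall s : nat,
     (r ^ 2 * (p ^ e - 1) <= p ^ s)%N ->
     ~ [/\ r = 1%N, p = 2%N, e = 1%N & s = 0%N] ->
     group_exponent_at_most p U s) /\
  ((r ^ 2 <= p)%N -> group_exponent_at_most p U e.+1).
Proof.
have [_ _ _ nU uU] := hU.1; have he1 := he.1.
have pr_p := pcharf_prime hp; have p1 := prime_gt1 pr_p.
have [j jA] := purely_insep_embedding iota hp he1.
suff main s : (r ^ 2 * (p ^ e - 1) <= p ^ s)%N ->
     ~ [/\ r = 1%N, p = 2%N, e = 1%N & s = 0%N] -> power_trivial U (p ^ s).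
  (* For s = e + 1 the exceptional case is void since s is nonzero, and r^2 (q - 1) <= p q = p^s. *)
  split=> [s hs hx|hr]; apply: is_minimal_exists; apply: main => //; last by case.
  by rewrite (expnS p) leq_mul // leq_subr.
case: r U hU nU uU => [|r'] U hU nU uU hs hx A g Ug.
  by rewrite [LHS]flatmx0 [RHS]flatmx0.
have gr := unipotent_normal_retr1 jA nU uU Ug.
have [F [FE _]] := retr_rmorphism jA A.
have hpT : p \in [pchar (tensor k' (restr iota A))].
  by rewrite (rmorph_pchar (tens_l (restr iota A))) // (rmorph_pchar (GRing.in_alg k')).
have Fq x : F x = 0 -> x ^+ (p ^ e) = 0.
  move=> Fx; rewrite (retr_expr jA x hp he1) FE Fx expr0n expn_eq0.
  by rewrite (gtn_eqF (prime_gt0 pr_p)) rmorph0.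
pose N := g - 1.
have FN : map_mx F N = 0.
  rewrite map_mxB map_mx1 -gr; apply/eqP; rewrite subr_eq0; apply/eqP.
  by apply/matrixP => i l; rewrite !mxE FE.
rewrite -[g](subrKC 1) -/N expmx_pchar_1D //.
suff -> : N ^+ (p ^ s) = 0 by rewrite addr0.
have ps0 : (0 < p ^ s)%N by rewrite expn_gt0 prime_gt0.
(* If e = 0, the hypothesis on s only says 0 <= p^s, but q = 1 makes pi injective and N = 0. *)
case: (posnP e) => [e0|e0].
  have -> : N = 0.
    apply/matrixP => i l; rewrite [RHS]mxE -[LHS]expr1 -(expn0 p) -e0 Fq //.
    by have /matrixP/(_ i l) := FN; rewrite !mxE.
  by rewrite expr0n (gtn_eqF ps0).
suff le : (r'.+1 * p ^ e <= p ^ s)%N.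
  by rewrite -(subnKC le) exprD (expmx_eq0_of_ker hpT Fq FN) mul0r.
have q2 : (1 < p ^ e)%N by rewrite -(exp1n e) ltn_exp2r.
case: r' hs hx {U hU nU uU g Ug gr N FN} => [|r''] hs hx; last by nia.
(* For r = 1 the bound gives only q - 1 <= p^s. If s < e, then p^s <= q/p, so (p - 1) p^(e-1) <= 1;
   this forces p = 2, e = 1, s = 0, the excluded case, where q - 1 = p^s = 1 but q = 2. *)
rewrite mul1n leq_exp2l // leqNgt; apply/negP => se; apply: hx.
have pe : (p ^ e = p * p ^ e.-1)%N by rewrite -expnS prednK.
have le : (p ^ s <= p ^ e.-1)%N by rewrite leq_exp2l //; lia.
have pe1 : (p ^ e.-1 = 1)%N by move: hs; rewrite pe; nia.
have e1 : e = 1%N.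
  by move: pe1 => /eqP; rewrite -(expn0 p) eqn_exp2l // => /eqP; lia.
have s0 : s = 0%N by lia.
split=> //; move: hs; rewrite e1 s0 expn0 expn1; lia.
Qed.
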